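(* Let $K$ be a finite simplicial complex, let $\mathcal{F}=\mathcal{F}(K)$ be its face poset (including the empty face) and $\hat{\mathcal{F}}=\mathcal{F}\cup\{\hat1\}$ its face lattice, and assume that $\hat{\mathcal{F}}$ admits a recursive coatom ordering. Then for every $\alpha\in\hat{\mathcal{F}}\setminus\{\hat0,\hat1\}$ (i.e. every nonempty face $\alpha$ of $K$), the poset $\hat{\mathcal{F}}_\alpha=\mathrm{Bl}_\alpha(\mathcal{F})\cup\{\hat1\}$ also admits a recursive coatom ordering.
   Context: $\hat1$ is a new top element; $\hat0$ is the empty face. For a semilattice $\mathcal{M}$ and $\alpha\in\mathcal{M}$, the combinatorial blowup $\mathrm{Bl}_\alpha\mathcal{M}$ is the poset with elements $\{x\in\mathcal{M}: x\not\ge\alpha\}\cup\{[\alpha,x]: x\in\mathcal{M},\ x\not\ge\alpha,\ x\vee\alpha\text{ exists}\}$ (the $[\alpha,x]$ being new formal symbols), ordered by: for $y,z\not\ge\alpha$, $y>z$ if $y>z$ in $\mathcal{M}$; $[\alpha,y]>[\alpha,z]$ if $y>z$ in $\mathcal{M}$; $[\alpha,y]>z$ if $y\ge z$ in $\mathcal{M}$. A bounded poset $P$ admits a recursive coatom ordering if $P=\{\hat0,\hat1\}$, or there is an ordering $c_1,\dots,c_r$ of its coatoms such that: (R) for every $j$, the interval $[\hat0,c_j]$ admits a recursive coatom ordering in which the coatoms of $[\hat0,c_j]$ contained in some $[\hat0,c_i]$ with $i<j$ come before all other coatoms; (S) for all $1\le i<k\le r$ and all $x\in P$ with $x\le c_i$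 and $x\le c_k$, there exist $j<k$ and a coatom $\omega$ of $[\hat0,c_k]$ with $x\le\omega\le c_j$. *)

(* Defs.v *)
From HB Require Import structures.
From mathcomp Require Import all_boot all_order.

Set Implicit Arguments.
Unset Strict Implicit.
Unset Printing Implicit Defensive.

Import Order.Theory.
Local Open Scope order_scope.

(* A simplicial complex contains the empty face; points v of V with
   [set v] \notin K are allowed and are simply not vertices of K. *)
Record simplicialComplex (V : finType) := SimplicialComplex {
  faces :> {set {set V}};
  faces_set0 : set0 \in faces;
  faces_sub : forall A B : {set V}, B \in faces -> A \subset B -> A \in faces
}.

Section FacePoset.
Variables (V : finType) (K : simplicialComplex V).

Record face := Face { face_set :> {set V}; face_mem : face_set \in faces K }.

HB.instance Definition _ := [isSub for face_set].
HB.instance Definition _ := [Finite of face by <:].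

Definition face_le (A B : face) : bool := face_set A \subset face_set B.

Fact face_le_refl : reflexive face_le.
Proof. by move=> A; apply: subxx. Qed.

Fact face_le_anti : antisymmetric face_le.
Proof. by move=> A B AB; apply/val_inj/eqP; rewrite eqEsubset. Qed.

Fact face_le_trans : transitive face_le.
Proof. by move=> A B C; apply: subset_trans. Qed.

Fact face_display : Order.disp_t. Proof. exact: (Order.Disp tt tt). Qed.

HB.instance Definition _ := Order.Le_isPOrder.Build face_display face
  face_le_refl face_le_anti face_le_trans.

Fact face_meet_mem (A B : face) : face_set A :&: face_set B \in faces K.
Proof. by apply: (faces_sub (face_mem A)); apply: subsetIl. Qed.

Definition face_meet (A B : face) : face := Face (face_meet_mem A B).

Fact face_lexI (A B C : face) :
  (A <= face_meet B C) = (A <= B) && (A <= C).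
Proof. exact: subsetI. Qed.

HB.instance Definition _ :=
  Order.POrder_isMeetSemilattice.Build face_display face face_lexI.

Definition empty_face : face := Face (faces_set0 K).

Fact face_le0x (A : face) : empty_face <= A.
Proof. exact: sub0set. Qed.

HB.instance Definition _ :=
  Order.hasBottom.Build face_display face face_le0x.

End FacePoset.

Definition hat (T : Type) : Type := option T.

Section Hat.
Variables (d : Order.disp_t) (T : finPOrderType d).

HB.instance Definition _ := Finite.on (hat T).

Definition hat_le (x y : hat T) : bool :=
  match x, y with
  | _, None => true
  | None, Some _ => false
  | Some a, Some b => a <= b
  end.

Fact hat_le_refl : reflexive hat_le.
Proof. by case=> //= a; apply: lexx. Qed.

Fact hat_le_anti : antisymmetric hat_le.
Proof. by case=> [a|] [b|] //= ab; congr Some; apply: le_anti. Qed.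

Fact hat_le_trans : transitive hat_le.
Proof. by case=> [a|] [b|] [c|] //=; apply: le_trans. Qed.

HB.instance Definition _ := Order.Le_isPOrder.Build d (hat T)
  hat_le_refl hat_le_anti hat_le_trans.

Fact hat_lex1 (x : hat T) : x <= (None : hat T).
Proof. by case: x. Qed.

HB.instance Definition _ := Order.hasTop.Build d (hat T) hat_lex1.

End Hat.

Section Blowup.
Variables (d : Order.disp_t) (M : finMeetSemilatticeType d).

Definition is_join (x y z : M) : bool :=
  [&& x <= z, y <= z & [forall w, (x <= w) && (y <= w) ==> (z <= w)]].

Definition join_exists (x y : M) : bool := [exists z, is_join x y z].

Variable alpha : M.

(* inl x is the old element x, and inr x is the formal symbol [alpha, x]. *)
Definition blowup : Type :=
  ({x : M | ~~ (alpha <= x)} +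
   {x : M | ~~ (alpha <= x) && join_exists x alpha})%type.

HB.instance Definition _ := Finite.on blowup.

Definition blowup_lt (u v : blowup) : bool :=
  match u, v with
  | inl z, inl y => val z < val y
  | inr z, inr y => val z < val y
  | inl z, inr y => val z <= val y
  | inr _, inl _ => false
  end.

Fact blowup_lt_irr : irreflexive blowup_lt.
Proof. by case=> x /=; apply: ltxx. Qed.

Fact blowup_lt_trans : transitive blowup_lt.
Proof.
case=> [y|y] [x|x] [z|z] //=.
- exact: lt_trans.
- by move=> /ltW; apply: le_trans.
- by move=> xy /ltW; apply: le_trans.
- exact: lt_trans.
Qed.

HB.instance Definition _ := Order.Lt_isPOrder.Build d blowup
  blowup_lt_irr blowup_lt_trans.

End Blowup.

Section RecursiveCoatomOrdering.
Variables (d : Order.disp_t) (P : finPOrderType d).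

Definition interval_coatom (z c w : P) : bool :=
  [&& z <= w, w < c & [forall y, ~~ ((w < y) && (y < c))]].

(* rec_coatom_ordering z c s: the sequence s is a recursive coatom ordering of
   the interval [z, c]. Its subintervals [z, c_j] are again intervals of P. *)
Inductive rec_coatom_ordering (z c : P) : seq P -> Prop :=
| RcoBase :
    z < c -> (forall x : P, z <= x -> x <= c -> x = z \/ x = c) ->
    rec_coatom_ordering z c [:: z]
| RcoStep (s : seq P) :
    uniq s -> s =i interval_coatom z c ->
    (forall j : nat, (j < size s)%N ->
       exists t : seq P,
         rec_coatom_ordering z (nth z s j) t /\
         (forall a b : P, a \in t -> b \in t ->
            (exists2 i : nat, (i < j)%N & a <= nth z s i) ->
            ~ (exists2 i : nat, (i < j)%N & b <= nth z s i) ->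
            (index a t < index b t)%N)) ->
    (forall i k : nat, (i < k)%N -> (k < size s)%N ->
       forall x : P, z <= x -> x <= nth z s i -> x <= nth z s k ->
         exists j : nat, exists w : P,
           [/\ (j < k)%N, interval_coatom z (nth z s k) w,
               x <= w & w <= nth z s j]) ->
    rec_coatom_ordering z c s.

Definition admits_rec_coatom_ordering : Prop :=
  exists z c : P,
    [/\ forall x : P, z <= x, forall x : P, x <= c
      & exists s : seq P, rec_coatom_ordering z c s].

End RecursiveCoatomOrdering.

Arguments admits_rec_coatom_ordering {d} P.

(* Main.v *)
(**
The blowup at [alpha] is the face poset of the stellar subdivision of [K] at
[alpha], the vertex set being enlarged by one new point. Intervals below a face
of a simplicial complex are Boolean, and every ordering of the coatoms of a
Boolean lattice is a recursive coatom ordering, so a recursive coatom ordering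
of a face lattice is the same thing as a (nonpure) shelling of the complex.
Given a shelling, replace every facet [F] containing [alpha] by its pieces
[new point + (F - a)], [a] in [alpha], listing first those [a] for which [F - a]
lies in an earlier facet; the result is a shelling of the subdivision.
*)

Require Import Defs.
From HB Require Import structures.
From mathcomp Require Import all_boot all_order.
Import Order.Theory.
Local Open Scope order_scope.

Set Implicit Arguments.
Unset Strict Implicit.
Unset Printing Implicit Defensive.

(* Facets are listed in reverse: the head of the sequence is the last facet of
   the shelling. *)
Fixpoint rev_shelling (W : finType) (s : seq {set W}) : Prop :=
  if s is F :: p then
    (forall G, G \in p ->
       [/\ ~~ (F \subset G), ~~ (G \subset F)
         & exists H u, [/\ H \in p, u \in F, u \notin G & F :\ u \subset H]])
    /\ rev_shelling p
  else True.

(** * Elementary properties of shellings *)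

Lemma rev_shelling_catr (W : finType) (s1 s2 : seq {set W}) :
  rev_shelling (s1 ++ s2) -> rev_shelling s2.
Proof. by elim: s1 => //= F p IH [_ /IH]. Qed.

Lemma rev_shelling_uniq (W : finType) (s : seq {set W}) :
  rev_shelling s -> uniq s.
Proof.
elim: s => //= F p IH [Fp /IH ->]; rewrite andbT.
by apply/negP => /Fp[]; rewrite subxx.
Qed.

Lemma rev_shelling_antichain (W : finType) (s : seq {set W}) :
  rev_shelling s -> {in s &, forall A B : {set W}, A \subset B -> A = B}.
Proof.
elim: s => //= F p IH [Fp /IH Hp] A B; rewrite !inE.
case/predU1P=> [->|Ap] /predU1P[->|Bp] // AB.
- by case: (Fp _ Bp); rewrite AB.
- by case: (Fp _ Ap); rewrite AB.
- exact: Hp.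
Qed.

(** * Shelling the stellar subdivision *)

Section StellarSubdivision.
Variables (V : finType) (al : {set V}).
Implicit Types (F G H : {set V}) (p s : seq {set V}) (l : seq V).

(** The subdivision lives on [option V], with [None] as the new point; for [a] in [al], [starf F a]
    is the piece of [F] opposite to [a]. *)
Definition oldf F : {set option V} := Some @: F.
Definition starf F (a : V) : {set option V} := None |: oldf (F :\ a).

(** Here [p] holds the facets shelled before [F]; for [u] in [F], the ridge opposite to [u] is then
    already present. *)
Definition covered p F : pred V :=
  fun u => has (fun H => F :\ u \subset H) p.

(** As the listing is reversed, the uncovered pieces stand in front: the covered ones are shelled
    first. *)
Fixpoint stellar_facets s : seq {set option V} :=
  if s is F :: p then
    (if al \subset F then
       [seq starf F a | a <- [seq a <- enum al | ~~ covered p F a]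
                          ++ [seq a <- enum al | covered p F a]]
     else [:: oldf F]) ++ stellar_facets p
  else [::].

Lemma mem_old F x : (Some x \in oldf F) = (x \in F).
Proof. by rewrite mem_imset //; apply: Some_inj. Qed.

Lemma None_old F : (None \in oldf F) = false.
Proof. by apply/imsetP => -[]. Qed.

Lemma mem_star F a x : (Some x \in starf F a) = (x != a) && (x \in F).
Proof. by rewrite !inE mem_old !inE. Qed.

Lemma None_star F a : None \in starf F a.
Proof. by rewrite !inE. Qed.

Definition memE := (mem_old, None_old, mem_star, None_star).

Lemma osubsetP (A B : {set option V}) :
  (None \in A -> None \in B) -> (forall x, Some x \in A -> Some x \in B) ->
  A \subset B.
Proof. by move=> HN HS; apply/subsetP => -[x|] //; apply: HS. Qed.

Lemma old_subset F G : (oldf F \subset oldf G) = (F \subset G).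
Proof.
apply/idP/idP => [/subsetP FG|FG]; last exact: imsetS.
by apply/subsetP => x; rewrite -!mem_old => /FG.
Qed.

Lemma stellar_facetsP s (A : {set option V}) :
  reflect ((exists2 F, F \in s & ~~ (al \subset F) /\ A = oldf F) \/
           (exists F a, [/\ F \in s, al \subset F, a \in al & A = starf F a]))
          (A \in stellar_facets s).
Proof.
apply: (iffP idP).
  elim: s => //= F p IH; rewrite mem_cat => /orP[|/IH]; last first.
    case=> [[G Gp HG]|[G [a [Gp HG aal ->]]]].
      by left; exists G; rewrite // inE Gp orbT.
    by right; exists G, a; rewrite inE Gp orbT.
  case: ifPn => alF; last first.
    by rewrite inE => /eqP->; left; exists F; rewrite // mem_head.
  case/mapP=> a; rewrite mem_cat !(mem_filter, mem_enum) => aal ->.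
  right; exists F, a; rewrite mem_head; split=> //.
  by case/orP: aal => /andP[].
elim: s => [|F p IH] /=; first by case=> [[]|[F [a []]]].
rewrite mem_cat => H; apply/orP; case: H.
  case=> G; rewrite inE => /predU1P[->|Gp] [HG AE].
    by left; rewrite AE (negPf HG) mem_head.
  by right; apply: IH; left; exists G.
case=> G [a [+ HG aal AE]]; rewrite inE => /predU1P[GF|Gp].
  rewrite AE -GF HG; left; apply: map_f.
  by rewrite mem_cat !(mem_filter, mem_enum) aal !andbT orNb.
by right; apply: IH; right; exists G, a.
Qed.

Lemma stellar_old s F :
  F \in s -> ~~ (al \subset F) -> oldf F \in stellar_facets s.
Proof. by move=> Fs HF; apply/stellar_facetsP; left; exists F. Qed.

Lemma stellar_star s F a :
  F \in s -> al \subset F -> a \in al -> starf F a \in stellar_facets s.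
Proof. by move=> Fs HF aal; apply/stellar_facetsP; right; exists F, a. Qed.

(** [l] lists the vertices whose pieces are already placed, and the disjunction encodes the order
    covered before uncovered. Two pieces of [F] share the ridge missing both vertices; any other
    earlier facet is treated through the facet of [p] it comes from. *)
Lemma rev_shelling_star_step p F l a :
    rev_shelling (F :: p) -> al \subset F -> {subset l <= al} ->
    a \in al -> a \notin l ->
    covered p F a \/ (forall u, u \in al -> covered p F u -> u \in l) ->
    rev_shelling ([seq starf F b | b <- l] ++ stellar_facets p) ->
  rev_shelling ([seq starf F b | b <- a :: l] ++ stellar_facets p).
Proof.
move=> [Fp _] alF lal aal al' Hcov IH /=; split=> // G'.
have aF : a \in F := subsetP alF _ aal.
rewrite mem_cat => /orP[/mapP[b bl ->]|].
  have ab : a != b by apply: contraNneq al' => ->.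
  have bF : b \in F := subsetP alF _ (lal _ bl).
  split.
  - by apply/subsetPn; exists (Some b); rewrite memE ?eqxx // eq_sym ab.
  - by apply/subsetPn; exists (Some a); rewrite memE ?eqxx // ab.
  - exists (starf F b), (Some b); rewrite !memE eqxx eq_sym ab bF; split=> //.
      by rewrite mem_cat map_f.
    apply: osubsetP; first by rewrite None_star.
    by move=> x; rewrite in_setD1 !memE => /and3P[xb _ ->]; rewrite andbT.
move=> G'p.
(* Besides incomparability, two facts about [G'] suffice: its old vertices lie in its parent [G],
   and it contains [None] only if [al] lies in [G]. *)
have [G Gp [G'G [NG' starG' G'star]]] : exists2 G, G \in p &
    (forall x, Some x \in G' -> x \in G) /\
    [/\ None \in G' -> al \subset G,
       ~~ (starf F a \subset G') & ~~ (G' \subset starf F a)].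
  case/stellar_facetsP: G'p => [[G Gp [HG ->]]|[G [b [Gp HG bal ->]]]];
    exists G => //; case: (Fp _ Gp) => FG GF _; split.
  - by move=> x; rewrite memE.
  - split; first by rewrite memE.
      by apply/subsetPn; exists None; rewrite memE.
    case/subsetPn: GF => x xG xF; apply/subsetPn; exists (Some x);
      by rewrite memE // negb_and xF orbT.
  - by move=> x; rewrite memE => /andP[].
  - split=> //.
      case/subsetPn: FG => x xF xG; apply/subsetPn; exists (Some x);
        rewrite memE ?xF ?andbT ?negb_and ?xG ?orbT //.
      by apply: contraNneq xG => ->; apply: (subsetP HG).
    case/subsetPn: GF => x xG xF; apply/subsetPn; exists (Some x);
      rewrite memE ?xG ?andbT ?negb_and ?xF ?orbT //.
    by apply: contraNneq xF => ->; apply: (subsetP alF).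
split=> //; case: (Fp _ Gp) => _ _ [H [u [Hp uF uG FuH]]].
have uG' : Some u \notin G' by apply: contraNN uG => /G'G.
(* If [u] is outside [al], then [al] survives in [F :\ u], hence in [H], and the piece of [H] at the
   same [a] works. *)
have [ual|ual] := boolP (u \in al); last first.
  have ua : u != a by apply: contraNneq ual => ->.
  have alH : al \subset H.
    apply: subset_trans FuH; apply/subsetP => x xal.
    rewrite !inE (subsetP alF) // andbT; by apply: contraNneq ual => <-.
  exists (starf H a), (Some u); rewrite memE ua uF; split=> //.
    by rewrite mem_cat stellar_star ?orbT.
  apply: osubsetP; first by rewrite None_star.
  move=> x; rewrite in_setD1 !memE => /and3P[xu -> xF] /=.
  by apply: (subsetP FuH); rewrite !inE xF andbT.
have NG : None \notin G'.
  by apply: contraNN uG => /NG' /subsetP; apply.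
have covu : covered p F u by apply/hasP; exists H.
(* Now [u] is in [al]. If [J] covers [a], the vertex to drop is [None]: [J] stays whole, since
   containing [al] as well as [F :\ a] would make it contain [F]. *)
have [/hasP[J Jp FaJ]|ncova] := boolP (covered p F a).
  exists (oldf J), None; rewrite None_star; split=> //.
    rewrite mem_cat stellar_old ?orbT //; apply/negP => /subsetP alJ.
    case: (Fp _ Jp) => /negP[]; apply/subsetP => x xF.
    have [->|xa] := eqVneq x a; first exact: alJ.
    by apply: (subsetP FaJ); rewrite !inE xa.
  apply: osubsetP; first by rewrite !inE.
  move=> x; rewrite in_setD1 !memE => /and3P[_ xa xF].
  by apply: (subsetP FaJ); rewrite !inE xa.
(* With [a] uncovered, the piece of the covered vertex [u] is already placed, and it contains all of
   [starf F a] except [u]. *)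
case: Hcov => [|/(_ _ ual covu) ul]; first by rewrite (negPf ncova).
have ua : u != a by apply: contraNneq al' => <-.
exists (starf F u), (Some u); rewrite memE ua uF; split=> //.
  by rewrite mem_cat map_f.
apply: osubsetP; first by rewrite None_star.
by move=> x; rewrite in_setD1 !memE => /and3P[-> _ ->].
Qed.

Lemma rev_shelling_stellar s :
  rev_shelling s -> rev_shelling (stellar_facets s).
Proof.
elim: s => //= F p IH [Fp /[dup] sp /IH {}IH].
have sFp : rev_shelling (F :: p) by split.
case: ifPn => alF.
  have ualc : uniq [seq a <- enum al | covered p F a].
    by rewrite filter_uniq ?enum_uniq.
  have uall : uniq ([seq a <- enum al | ~~ covered p F a] ++
                    [seq a <- enum al | covered p F a]).
    rewrite cat_uniq ualc filter_uniq ?enum_uniq // andbT.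
    apply/hasPn => x; rewrite !mem_filter => /andP[-> _]; exact: isT.
  have Sc : {subset [seq a <- enum al | covered p F a] <= al}.
    by move=> x; rewrite mem_filter mem_enum => /andP[].
  have Snc : {subset [seq a <- enum al | ~~ covered p F a] <= al}.
    by move=> x; rewrite mem_filter mem_enum => /andP[].
  (* The covered pieces go directly onto the subdivision of [p]. *)
  have shc : rev_shelling ([seq starf F b |
      b <- [seq a <- enum al | covered p F a]] ++ stellar_facets p).
    have allc : all (covered p F) [seq a <- enum al | covered p F a].
      exact: filter_all.
    elim: {uall} [seq a <- enum al | covered p F a] ualc Sc allc
      => //= a l IHl /andP[al' ul] Sl /andP[ca cl].
    apply: rev_shelling_star_step => //.
    - by move=> x xl; apply: Sl; rewrite inE xl orbT.
    - by apply: Sl; rewrite mem_head.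
    - by left.
    - by apply: IHl => // x xl; apply: Sl; rewrite inE xl orbT.
  (* The uncovered pieces follow; by then every covered vertex of [al] is in the list. *)
  elim: [seq a <- enum al | ~~ covered p F a] uall Snc
    => //= a l IHl /andP[al' ul] Sl.
  apply: (@rev_shelling_star_step _ _ (l ++ _)) => //.
  - move=> x; rewrite mem_cat => /orP[xl|]; last exact: Sc.
    by apply: Sl; rewrite inE xl orbT.
  - by apply: Sl; rewrite mem_head.
  - by right=> u ual cu; rewrite mem_cat mem_filter cu mem_enum ual orbT.
  - by apply: IHl => // x xl; apply: Sl; rewrite inE xl orbT.
split=> // G' G'p.
have [G Gp [G'G [oldG' G'old]]] : exists2 G, G \in p &
    (forall x, Some x \in G' -> x \in G) /\
    ~~ (oldf F \subset G') /\ ~~ (G' \subset oldf F).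
  case/stellar_facetsP: G'p => [[G Gp [HG ->]]|[G [b [Gp HG bal ->]]]];
    exists G => //; case: (Fp _ Gp) => FG GF _; split.
  - by move=> x; rewrite memE.
  - by rewrite !old_subset.
  - by move=> x; rewrite memE => /andP[].
  - split; last by apply/subsetPn; exists None; rewrite memE.
    case/subsetPn: FG => x xF xG; apply/subsetPn; exists (Some x);
      by rewrite memE // negb_and xG orbT.
split=> //; case: (Fp _ Gp) => _ _ [H [u [Hp uF uG FuH]]].
have uG' : Some u \notin G' by apply: contraNN uG => /G'G.
have [alH|alH] := boolP (al \subset H); last first.
  exists (oldf H), (Some u); rewrite memE stellar_old //; split=> //.
  apply: osubsetP; first by rewrite in_setD1 !memE andbF.
  move=> x; rewrite in_setD1 !memE => /andP[xu xF].
  by apply: (subsetP FuH); rewrite !inE xF andbT.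
(* Here [H] is subdivided but [F] is not: removing from [H] a vertex of [al] outside [F] leaves
   [F :\ u] inside the piece. *)
case/subsetPn: alF => a aal aF.
exists (starf H a), (Some u); rewrite memE stellar_star //; split=> //.
apply: osubsetP; first by rewrite None_star.
move=> x; rewrite in_setD1 !memE => /andP[xu xF].
rewrite (subsetP FuH) ?andbT; last by rewrite !inE xF andbT.
by apply: contraNneq aF => <-.
Qed.

End StellarSubdivision.

(** Serves the order condition of the recursive clause: any ordering of the coatoms of a Boolean
    interval will do, so those below earlier coatoms can be moved to the front. *)
Lemma reorder_early (T : eqType) (E : pred T) (e : seq T) : uniq e ->
  exists t, [/\ uniq t, t =i e
    & forall a b, a \in t -> b \in t -> E a -> ~~ E b ->
        (index a t < index b t)%N].
Proof.
move=> ue; exists ([seq b <- e | E b] ++ [seq b <- e | ~~ E b]); split.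
- rewrite cat_uniq !filter_uniq // andbT.
  by apply/hasPn => b; rewrite !mem_filter => /andP[/negPf->].
- by move=> b; rewrite mem_cat !mem_filter -andb_orl orbN.
move=> a b; rewrite !mem_cat !mem_filter => ae be Ea Eb.
move: ae be; rewrite Ea (negPf Eb) /= orbF => ae be.
rewrite !index_cat !mem_filter Ea (negPf Eb) ae /=.
by rewrite ltn_addr // index_mem mem_filter Ea.
Qed.

Lemma has_takeP (T : Type) (x0 : T) (p : pred T) (s : seq T) (j : nat) :
  (j <= size s)%N ->
  reflect (exists2 i, (i < j)%N & p (nth x0 s i)) (has p (take j s)).
Proof.
move=> js; apply: (iffP (has_nthP x0)); rewrite size_takel // => -[i ij pi];
  by exists i; rewrite // nth_take in pi *.
Qed.

(** * Recursive coatom orderings versus shellings *)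

Section SimplicialPoset.
Variables (d : Order.disp_t) (T : finPOrderType d) (W : finType).
(** [phi] identifies [T] with the face poset of a complex on [W]. This abstraction allows the same
    argument for [K] and for the blowup. *)
Variable phi : T -> {set W}.
Hypothesis phi_le : forall x y, (x <= y) = (phi x \subset phi y).
Hypothesis phi_down :
  forall x (A : {set W}), A \subset phi x -> exists y, phi y = A.

(** A shelling is an antichain, so the last two clauses force [r] to list exactly the maximal
    faces. *)
Definition shelling_of (r : seq {set W}) : Prop :=
  [/\ rev_shelling r, forall A, A \in r -> exists t, phi t = A
    & forall t, exists2 A, A \in r & phi t \subset A].

Lemma embed_lt x y : (x < y) = (phi x \proper phi y).
Proof. by rewrite lt_leAnge properE !phi_le. Qed.

Lemma embed_inj : injective phi.
Proof. by move=> x y E; apply/le_anti; rewrite !phi_le E subxx. Qed.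

Lemma maximal_above (t : T) :
  exists2 m, t <= m & forall y, m <= y -> y = m.
Proof.
case: (@arg_maxnP _ t (fun y => t <= y) (fun y => #|phi y|)) => // m tm mmax.
exists m => // y my; apply: embed_inj; apply/esym/eqP.
by rewrite eqEcard -phi_le my; apply: mmax; apply: le_trans tm my.
Qed.

Variable z : T.
Hypothesis phi_z : phi z = set0.

Lemma hat_leS (x y : T) : (Some x <= Some y :> hat T) = (x <= y).
Proof. by []. Qed.

Lemma hat_ltS (x y : T) : (Some x < Some y :> hat T) = (x < y).
Proof. by rewrite !lt_leAnge. Qed.

Lemma hat_ltN (x : hat T) : (x < None :> hat T) = isSome x.
Proof. by rewrite lt_leAnge; case: x. Qed.

Lemma hat_ltNx (x : hat T) : (None < x :> hat T) = false.
Proof. by rewrite lt_leAnge; case: x. Qed.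

Lemma hat_ge_bot (x : hat T) : Some z <= x :> hat T.
Proof. by case: x => // x; rewrite hat_leS phi_le phi_z sub0set. Qed.

Lemma coatom_faceP (t : T) (w : hat T) :
  reflect (exists2 s, w = Some s & exists2 u, u \in phi t & phi s = phi t :\ u)
          (interval_coatom (Some z : hat T) (Some t) w).
Proof.
rewrite /interval_coatom hat_ge_bot /=; apply: (iffP andP).
  case: w => [s|]; last by rewrite hat_ltNx => -[].
  rewrite hat_ltS embed_lt => -[/properP[st [u ut us]] /forallP Hmax].
  exists s => //; exists u => //.
  have [y Ey] := phi_down (subsetDl (phi t) [set u]).
  have sy : s <= y by rewrite phi_le Ey subsetD1 st.
  have yt : y < t by rewrite embed_lt Ey properD1.
  have := Hmax (Some y); rewrite !hat_ltS yt andbT lt_neqAle sy andbT negbK.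
  by move/eqP->.
case=> s -> [u ut Es]; rewrite hat_ltS embed_lt Es properD1 //; split=> //.
apply/forallP => -[y|]; last by rewrite hat_ltNx andbF.
(* Nothing fits strictly between two sets whose cardinalities differ by one. *)
rewrite !hat_ltS !embed_lt Es; apply/negP => /andP[/proper_card sy].
by move/proper_card; rewrite (cardsD1 u (phi t)) ut add1n ltnS leqNgt sy.
Qed.

Lemma coatom_topP (w : hat T) :
  reflect (exists2 t, w = Some t & forall y, t <= y -> y = t)
          (interval_coatom (Some z : hat T) None w).
Proof.
rewrite /interval_coatom hat_ge_bot hat_ltN /=; apply: (iffP andP).
  case: w => [t|] [] // _ /forallP Hmax; exists t => // y ty.
  have := Hmax (Some y); rewrite hat_ltN hat_ltS andbT lt_neqAle ty andbT.
  by rewrite negbK => /eqP.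
case=> t -> tmax; split=> //; apply/forallP => -[y|]; last by rewrite hat_ltNx andbF.
rewrite hat_ltS hat_ltN andbT; apply/negP => /[dup] /ltW /tmax ->.
by rewrite ltxx.
Qed.

(** The interval is Boolean. Distinct coatoms delete distinct vertices [u] and [u'], and deleting
    both gives a common coatom, which settles (S) with [j = i]; (R) is induction on cardinality. For
    the empty face [s] is empty and [RcoStep] holds vacuously. *)
Lemma rco_face (t : T) (s : seq (hat T)) :
    uniq s -> s =i interval_coatom (Some z : hat T) (Some t) ->
  rec_coatom_ordering (Some z : hat T) (Some t) s.
Proof.
have [n] := ubnP #|phi t|; elim: n t s => // n IH t s /ltnSE tn us sE.
have nthP k : (k < size s)%N -> exists2 x, nth (Some z) s k = Some x &
    exists2 u, u \in phi t & phi x = phi t :\ u.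
  by move=> ks; apply/coatom_faceP; have := mem_nth (Some z) ks; rewrite sE.
apply: RcoStep => // [j js|i k ik ks x _].
  have [x Ex [u ut Eu]] := nthP _ js.
  have [r [ur rE rlt]] := reorder_early
    (fun b : hat T => has (fun y => b <= y) (take j s))
    (enum_uniq (interval_coatom (Some z : hat T) (Some x))).
  exists r; rewrite Ex; split; last first.
    move=> a b ar br Ea Eb; apply: rlt => //; first exact/(has_takeP (Some z) _ (ltnW js)).
    by apply/negP => /(has_takeP (Some z) _ (ltnW js)).
  apply: IH => //; last by move=> b; rewrite rE mem_enum.
  by move: tn; rewrite (cardsD1 u) ut add1n Eu.
have [y Ey [u ut Eu]] := nthP _ (ltn_trans ik ks).
have [y' Ey' [u' ut' Eu']] := nthP _ ks.
have uu' : u != u'.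
  have : nth (Some z) s i != nth (Some z) s k.
    by rewrite nth_uniq ?(ltn_trans ik ks) // neq_ltn ik.
  rewrite Ey Ey'; apply: contraNneq => uu'.
  by apply/eqP; congr Some; apply: embed_inj; rewrite Eu Eu' uu'.
have [w Ew] := phi_down (subsetDl (phi y') [set u]).
rewrite Ey Ey' => xy xy'; exists i, (Some w); rewrite Ey; split=> //.
- apply/coatom_faceP; exists w => //; exists u => //.
  by rewrite Eu' !inE uu'.
- case: x xy xy' => // x; rewrite !hat_leS !phi_le Ew subsetD1 => xy -> /=.
  by apply/negP => /(subsetP xy); rewrite Eu !inE eqxx.
- by rewrite hat_leS phi_le Ew Eu Eu' setDDl setUC -setDDl subsetDl.
Qed.

Definition hat_set (x : hat T) : {set W} := if x is Some t then phi t else setT.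

(** The shelling is the reversed list of coatoms; [RcoBase] is the complex whose only face is
    empty. *)
Lemma shelling_of_rco (s : seq (hat T)) :
  rec_coatom_ordering (Some z : hat T) None s -> exists r, shelling_of r.
Proof.
case=> {s}[_ H|s us sE _ HS].
  exists [:: set0]; split=> // [A|t].
    by rewrite inE => /eqP->; exists z.
  exists set0; first exact: mem_head.
  case: (H (Some t)) => //; first exact: hat_ge_bot.
  by case=> ->; rewrite phi_z.
have nthP k : (k < size s)%N ->
    exists2 t, nth (Some z) s k = Some t & forall y, t <= y -> y = t.
  by move=> ks; apply/coatom_topP; have := mem_nth (Some z) ks; rewrite sE.
exists (rev (map hat_set s)); split.
- suff : forall k, (k <= size s)%N -> rev_shelling (rev (map hat_set (take k s))).
    by move/(_ _ (leqnn _)); rewrite take_size.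
  elim=> [|k IH] ks; first by rewrite take0.
  rewrite (take_nth (Some z)) // map_rcons rev_rcons; split; last exact/IH/ltnW.
  have [t Et tmax] := nthP _ ks; rewrite Et /= => G.
  rewrite mem_rev => /mapP[w /(seq.nthP (Some z))[i]]; rewrite size_takel ?(ltnW ks) // => ik.
  rewrite nth_take // => <- {w} ->.
  have iS := ltn_trans ik ks.
  have [t' Et' tmax'] := nthP _ iS; rewrite Et' /=.
  have tt' : t != t'.
    have : nth (Some z) s k != nth (Some z) s i by rewrite nth_uniq // neq_ltn ik orbT.
    by rewrite Et Et'; apply: contraNneq => ->.
  split.
  - by rewrite -phi_le; apply: contraNN tt' => /tmax ->.
  - by rewrite -phi_le; apply: contraNN tt' => /tmax' ->.
  (* (S) is applied to the intersection of the two facets: the coatom above it deletes a vertex [u]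
     of [phi t], which therefore lies outside [phi t']. *)
  have [x Ex] := phi_down (subsetIl (phi t) (phi t')).
  have [|||j [w [jk]]] := HS i k ik ks (Some x).
  - exact: hat_ge_bot.
  - by rewrite Et' hat_leS phi_le Ex subsetIr.
  - by rewrite Et hat_leS phi_le Ex subsetIl.
  rewrite Et => /coatom_faceP[y -> [u ut Eu]].
  have [v Ev _] := nthP _ (ltn_trans jk ks).
  rewrite Ev !hat_leS !phi_le Ex Eu => xu uv; exists (phi v), u; split=> //.
    rewrite mem_rev; apply/mapP; exists (Some v) => //.
    apply/(seq.nthP (Some z)); exists j; first by rewrite size_takel ?(ltnW ks).
    by rewrite nth_take.
  by apply/negP => ut'; have /subsetP/(_ u) := xu; rewrite !inE ut ut' eqxx => /(_ isT).
- move=> A; rewrite mem_rev => /mapP[w]; rewrite sE => /coatom_topP[t -> _] ->.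
  by exists t.
- move=> t; have [m tm mmax] := maximal_above t.
  exists (phi m); last by rewrite -phi_le.
  rewrite mem_rev; apply/mapP; exists (Some m) => //; rewrite sE.
  by apply/coatom_topP; exists m.
Qed.

(** The facets are lifted through [phi] and put back in forward order. (R) comes from [rco_face],
    and (S) from the ridge [F :\ u] of the shelling condition. *)
Lemma rco_of_shelling r :
  shelling_of r -> exists s, @rec_coatom_ordering _ (hat T) (Some z) None s.
Proof.
case=> shr rT rcov.
have [q Eq] : exists q, map phi q = r.
  elim: r rT {shr rcov} => [|A r IH] rT; first by exists [::].
  have [t Et] := rT A (mem_head _ _).
  have [|q Eq] := IH; last by exists (t :: q); rewrite /= Et Eq.
  by move=> B Br; apply: rT; rewrite inE Br orbT.
have uq : uniq (rev q).
  by rewrite rev_uniq; apply: (@map_uniq _ _ phi); rewrite Eq; apply: rev_shelling_uniq.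
have anti := rev_shelling_antichain shr.
(* An antichain of faces that lies above every face is the set of maximal faces. *)
have sE : map Some (rev q) =i @interval_coatom _ (hat T) (Some z) None.
  move=> w; apply/mapP/coatom_topP => -[t].
    rewrite mem_rev => tq ->; exists t => // y ty.
    have [A Ar yA] := rcov y.
    have tr : phi t \in r by rewrite -Eq map_f.
    have tA : phi t = A.
      by apply: anti => //; apply: subset_trans yA; rewrite -phi_le.
    by apply/le_anti; rewrite ty phi_le tA yA.
  move=> -> tmax; exists t => //; rewrite mem_rev.
  have [A Ar] := rcov t; move: Ar; rewrite -Eq => /mapP[y yq ->].
  by rewrite -phi_le => /tmax <-.
exists (map Some (rev q)); apply: RcoStep => //.
- by rewrite map_inj_uniq //; apply: Some_inj.
- move=> j js; rewrite (nth_map z) -1?(size_map Some) //.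
  have [l [ul lE llt]] := reorder_early
    (fun b : hat T => has (fun y => b <= y) (take j (map Some (rev q))))
    (enum_uniq (interval_coatom (Some z : hat T) (Some (nth z (rev q) j)))).
  exists l; split.
    by apply: rco_face => // b; rewrite lE mem_enum.
  move=> a b al bl Ea Eb; apply: llt => //.
    exact/(has_takeP (Some z) _ (ltnW js)).
  by apply/negP => /(has_takeP (Some z) _ (ltnW js)).
move=> i k ik; rewrite size_map => ks x _.
rewrite !(nth_map z) ?(ltn_trans ik ks) // => xi xk.
have : rev_shelling (rev (map phi (rev q))) by rewrite -map_rev revK Eq.
(* Cutting at [k] makes the facet of index [k] the head of a suffix of the reversed list, followed
   exactly by the earlier facets. *)
rewrite -{1}(cat_take_drop k (rev q)) (drop_nth z ks) map_cat rev_cat /=.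
rewrite rev_cons -cats1 -catA => /rev_shelling_catr /= [+ _].
case/(_ (phi (nth z (rev q) i))).
  rewrite mem_rev map_f //; apply/(seq.nthP z); exists i.
    by rewrite size_takel // ltnW.
  by rewrite nth_take.
move=> _ _ [H [u []]]; rewrite mem_rev => /mapP[h /(seq.nthP z)[j]].
rewrite size_takel ?(ltnW ks) // => jk; rewrite nth_take // => Eh -> uk ui kh.
have [w Ew] := phi_down (subsetDl (phi (nth z (rev q) k)) [set u]).
exists j, (Some w); rewrite (nth_map z) ?(ltn_trans jk ks) // Eh; split=> //.
- by apply/coatom_faceP; exists w => //; exists u.
- case: x xi xk => // x; rewrite !hat_leS !phi_le Ew subsetD1 => xi -> /=.
  by apply: contraNN ui; apply: (subsetP xi).
- by rewrite hat_leS phi_le Ew.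
Qed.

End SimplicialPoset.

(** * The blowup as the face poset of the subdivision *)

Section BlowupComplex.
Variables (V : finType) (K : simplicialComplex V) (alpha : face K).

Definition blowup_set (t : blowup alpha) : {set option V} :=
  match t with
  | inl x => oldf (face_set (val x))
  | inr x => None |: oldf (face_set (val x))
  end.

Definition blowup_base (t : blowup alpha) : face K :=
  match t with inl x => val x | inr x => val x end.

Lemma face_leE (x y : face K) : (x <= y) = (face_set x \subset face_set y).
Proof. by []. Qed.

(** Any common upper bound contains the union, which is then a face and is the join. *)
Lemma face_join_exists (x : face K) :
  join_exists x alpha = (face_set x :|: face_set alpha \in faces K).
Proof.
apply/existsP/idP => [[z /and3P[xz az _]]|xaK].
  by apply: (faces_sub (face_mem z)); rewrite subUset; apply/andP.
exists (Face xaK); apply/and3P; split; [exact: subsetUl | exact: subsetUr |].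
apply/forallP => w; apply/implyP => /andP[xw aw].
by rewrite face_leE subUset; apply/andP.
Qed.

(** The new point marks the formal symbols: it rules out a symbol below an old element, and
    otherwise inclusion is decided on the old vertices. *)
Lemma blowup_leE (x y : blowup alpha) :
  (x <= y) = (blowup_set x \subset blowup_set y).
Proof.
have subN (A B : {set V}) :
    (None |: oldf A \subset None |: oldf B) = (A \subset B).
  apply/idP/idP => [/subsetP AB|AB]; last by rewrite setUS ?old_subset.
  apply/subsetP => v vA; have := AB (Some v).
  by rewrite !inE !mem_old vA; apply.
rewrite le_eqVlt; case: x => x; case: y => y /=.
- rewrite old_subset; by rewrite -face_leE le_eqVlt.
- apply/idP/idP => [xy|/subsetP xy].
    by apply: subset_trans (subsetUr _ _); rewrite old_subset.
  apply/subsetP => v vx; have := xy (Some v).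
  by rewrite !inE !mem_old vx; apply.
- rewrite -[LHS]/false; apply/esym/negbTE/subsetPn; exists None;
    by rewrite ?None_old // !inE.
- rewrite subN; by rewrite -face_leE le_eqVlt.
Qed.

Lemma blowup_down (x : blowup alpha) (A : {set option V}) :
  A \subset blowup_set x -> exists y, blowup_set y = A.
Proof.
pose B : {set V} := Some @^-1: A.
have AB : A = if None \in A then None |: oldf B else oldf B.
  by apply/setP => -[v|]; case: ifPn => NA; rewrite ?inE ?memE ?inE ?(negPf NA).
have xal : ~~ (alpha <= blowup_base x) by case: x => -[y] //= /andP[].
move=> Ax; have Bx : B \subset face_set (blowup_base x).
  apply/subsetP => v; rewrite inE => /(subsetP Ax).
  by case: x {xal Ax} => y /=; rewrite ?inE memE.
have BK : B \in faces K := faces_sub (face_mem _) Bx.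
have Bal : ~~ (alpha <= Face BK).
  by apply: contraNN xal => aB; apply: le_trans aB _.
have [NA|NA] := boolP (None \in A); rewrite AB; last first.
  by exists (inl (exist _ (Face BK) Bal)); rewrite (negPf NA).
rewrite NA; case: x xal Bx Ax => y /= xal Bx Ax.
  by have /(subsetP Ax) := NA; rewrite None_old.
(* Joinability with [alpha] passes to subsets, because the union shrinks. *)
have BP : ~~ (alpha <= Face BK) && join_exists (Face BK) alpha.
  rewrite Bal face_join_exists /=; case/andP: (valP y) => _.
  by rewrite face_join_exists => /faces_sub; apply; apply: setSU.
by exists (inr (exist _ (Face BK) BP)).
Qed.

(** For the covering clause, a face [x] not containing [alpha] misses some [a] of [alpha]; if [F]
    contains both [x] and [alpha], then [x] fits in [F :\ a]. *)
Lemma shelling_of_blowup r :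
    shelling_of (@face_set V K) r ->
  shelling_of blowup_set (stellar_facets (face_set alpha) r).
Proof.
case=> shr rT rcov; split; first exact: rev_shelling_stellar.
  move=> A /stellar_facetsP[[F /rT[f <-] [aF ->]]|[F [a [/rT[f <-] aF aal ->]]]].
    by exists (inl (exist _ f aF)).
  have fK : face_set f :\ a \in faces K.
    exact: (faces_sub (face_mem f) (subsetDl _ _)).
  suff P : ~~ (alpha <= Face fK) && join_exists (Face fK) alpha.
    by exists (inr (exist _ (Face fK) P)).
  apply/andP; split.
    by apply/negP => /subsetP/(_ _ aal); rewrite !inE eqxx.
  rewrite face_join_exists; apply: (faces_sub (face_mem f)).
  by rewrite subUset subsetDl.
have star_cover (x : face K) F : F \in r -> face_set x \subset F ->
    ~~ (alpha <= x) -> face_set alpha \subset F ->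
    exists2 A, A \in stellar_facets (face_set alpha) r &
      None |: oldf (face_set x) \subset A.
  move=> Fr xF /subsetPn[a aal ax] aF; exists (starf F a); first exact: stellar_star.
  by rewrite setUS // old_subset subsetD1 xF.
case=> -[x /= xal].
  have [F Fr xF] := rcov x.
  have [aF|aF] := boolP (face_set alpha \subset F); last first.
    by exists (oldf F); [exact: stellar_old | rewrite old_subset].
  have [A Ar xA] := star_cover _ _ Fr xF xal aF; exists A => //.
  exact: subset_trans (subsetUr _ _) xA.
case/andP: xal => xal; rewrite face_join_exists => xaK.
(* Covering the join [x :|: alpha] yields one facet containing both. *)
have [F Fr /=] := rcov (Face xaK); rewrite subUset => /andP[xF aF].
exact: star_cover xF xal aF.
Qed.

End BlowupComplex.

Theorem theorem3p4 (V : finType) (K : simplicialComplex V)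
    (HK : admits_rec_coatom_ordering (hat (face K)))
    (alpha : face K) (Halpha : alpha != \bot) :
  admits_rec_coatom_ordering (hat (blowup alpha)).
Proof.
have down (x : face K) (A : {set V}) :
    A \subset face_set x -> exists y : face K, face_set y = A.
  by move=> Ax; exists (Face (faces_sub (face_mem x) Ax)).
have E : face_set (empty_face K) = set0 by [].
have [z [c [zbot ctop [s]]]] := HK.
have -> : z = Some (empty_face K).
  by apply/le_anti; rewrite zbot; apply: (hat_ge_bot (@face_leE V K) E).
have -> : c = None by apply/le_anti; rewrite ctop andbT; apply: hat_lex1.
case/(shelling_of_rco (@face_leE V K) down E) => r /(shelling_of_blowup alpha) shr.
(* As [alpha] is nonempty, the empty face survives the blowup and is its bottom. *)
have al0 : ~~ (alpha <= empty_face K) by rewrite (lex0 alpha).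
pose b0 : blowup alpha :=
  inl (exist (fun x : face K => ~~ (alpha <= x)) _ al0).
have E0 : blowup_set b0 = set0.
  by rewrite /= /oldf imset0.
exists (Some b0), None; split.
- exact: (hat_ge_bot (@blowup_leE _ _ alpha) E0).
- exact: hat_lex1.
- exact: (rco_of_shelling (@blowup_leE _ _ alpha) (@blowup_down _ _ alpha) E0 shr).
Qed.
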